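(* Let $T\ge1$, $G>0$, and let $f_1,\dots,f_T:\mathbb{R}^d\to\mathbb{R}$ be convex and $G$-Lipschitz. Let $f=\frac1T\sum_{t=1}^Tf_t$ and assume $f$ has a minimizer $x_*\in\arg\min f$. Consider the Incremental Proximal Method with step sizes $\eta_1,\dots,\eta_K>0$ (and $\eta_0:=\eta_1$), started at $x_0$, with inexact proximal point evaluations with accuracies $\varepsilon_{k-1,t}>0$ satisfying $$\sum_{t=1}^T\varepsilon_{k-1,t}\le\frac{\eta_k\eta_{k-1}GT}{\sum_{j=k}^K\eta_j}\qquad(1\le k\le K).$$ Then the output $x_K$ satisfies $$f(x_K)-f(x_* )\le\frac{\|x_0-x_*\|^2}{2T\sum_{k=1}^K\eta_k}+\frac{G^2T}{2}\sum_{k=1}^K\frac{\eta_k^2}{\sum_{j=k}^K\eta_j}+\sum_{k=1}^K\sum_{t=1}^T\Big(\frac{\varepsilon_{k-1,t}^2}{2T\sum_{j=k}^K\eta_j}+\frac{3G\varepsilon_{k-1,t}\eta_k}{\sum_{j=k}^K\eta_j}\Big).$$ Moreover, given $\epsilon>0$, if $\sum_{t=1}^T\varepsilon_{k-1,t}\le\frac{2\eta GT}{K-k+1}$ for $1\le k\le K$, then there exists a constant step size $\eta$ such that $f(x_K)-f(x_* )\le\epsilon$ after $TK=\widetilde{\mathcal{O}}\Big(\frac{G^2T\|x_0-x_*\|^2}{\epsilon^2}\Big)$ individual inexact proximal point evaluations.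
   Context: $\|\cdot\|$ is the Euclidean norm on $\mathbb{R}^d$. $g$ is $G$-Lipschitz if $|g(x)-g(y)|\le G\|x-y\|$ for all $x,y$. For convex $g$ and $\eta>0$, $\mathrm{prox}_{\eta g}(x)=\arg\min_{y\in\mathbb{R}^d}\{\frac{1}{2\eta}\|y-x\|^2+g(y)\}$. Incremental Proximal Method (IPM) with inexact proximal point evaluations: given $x_0\in\mathbb{R}^d$, number of epochs $K$, step sizes $\eta_k>0$ and accuracies $\varepsilon_{k-1,t}>0$; for $k=1,\dots,K$ set $x_{k-1,1}=x_{k-1}$, then for $t=1,\dots,T$ let $x_{k-1,t+1}$ be any point with $\|x_{k-1,t+1}-\mathrm{prox}_{\eta_kf_t}(x_{k-1,t})\|\le\varepsilon_{k-1,t}$, and set $x_k=x_{k-1,T+1}$. (Equivalently, with $g_{k-1,t}=\frac{1}{\eta_k}(x_{k-1,t}-x_{k-1,t+1})$ and $M_{\eta_kf_t}$ the Moreau envelope of $f_t$, $\|g_{k-1,t}-\nabla M_{\eta_kf_t}(x_{k-1,t})\|\le\varepsilon_{k-1,t}/\eta_k$.) The output is $x_K$; each epoch uses $T$ individual inexact proximal point evaluations. Convention for the complexity claim: $\widetilde{\mathcal O}(X)$ means at most $C\,X\,(\log(\mathrm{e}+X))^p$ for absolute constants $C,p>0$, and the claim is that there exist an integer $K$ and a step size $\eta$ (with $\eta_k=\eta$ for all $k$, allowed to depend on $K$ and the problem parameters) with $TK=\widetilde{\mathcal O}(X)$ such that $f(x_K)-f(x_* )\le\epsilon$ for every inexact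 run whose accuracies satisfy the stated condition for this $K$ and $\eta$; as usual the bound is read in the regime $X\ge T$ (at least one epoch). *)

(* Defs.v *)
From mathcomp Require Import all_boot all_order all_algebra.
From mathcomp Require Import all_classical all_reals all_analysis.

Set Implicit Arguments.
Unset Strict Implicit.
Unset Printing Implicit Defensive.

Import Order.TTheory GRing.Theory Num.Theory.
Local Open Scope classical_set_scope.
Local Open Scope ring_scope.

(* The canonical norm `|x| on 'rV[R]_d is the sup norm, hence [enorm]. *)
Definition enorm (R : realType) (d : nat) (x : 'rV[R]_d) : R :=
  Num.sqrt (\sum_(i < d) x ord0 i ^+ 2).

Definition elipschitz (R : realType) (d : nat) (G : R) (g : 'rV[R]_d -> R) :=
  forall x y, `|g x - g y| <= G * enorm (x - y).

Definition is_argmin (R : realType) (d : nat) (g : 'rV[R]_d -> R)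
    (p : 'rV[R]_d) :=
  forall y, g p <= g y.

(* For convex real-valued g on R^d and eta > 0 the minimizer exists and is
   unique, so the default value of [xget] is never returned. *)
Definition prox (R : realType) (d : nat) (eta : R) (g : 'rV[R]_d -> R)
    (x : 'rV[R]_d) : 'rV[R]_d :=
  xget 0 [set p | is_argmin (fun y => (2 * eta)^-1 * enorm (y - x) ^+ 2 + g y) p].

(* Components f 1, ..., f T and steps eta 1, ..., eta K are numbered from 1;
   values at other indices are irrelevant. *)
Definition favg (R : realType) (d T : nat) (f : nat -> 'rV[R]_d -> R)
    (x : 'rV[R]_d) : R :=
  T%:R^-1 * \sum_(1 <= t < T.+1) f t x.

(* [x k] is the outer iterate x_k and [z k t] the inner iterate x_{k,t}. *)
Definition ipm_run (R : realType) (d T K : nat) (f : nat -> 'rV[R]_d -> R)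
    (eta : nat -> R) (acc : nat -> nat -> R) (x0 : 'rV[R]_d)
    (x : nat -> 'rV[R]_d) (z : nat -> nat -> 'rV[R]_d) : Prop :=
  x 0%N = x0 /\
  forall k, (1 <= k <= K)%N ->
    [/\ z k.-1 1%N = x k.-1,
        forall t, (1 <= t <= T)%N ->
          enorm (z k.-1 t.+1 - prox (eta k) (f t) (z k.-1 t)) <= acc k.-1 t
      & x k = z k.-1 T.+1].

Definition soft_bigO (R : realType) (C p X : R) : R :=
  C * X * ln (expR 1 + X) `^ p.

(* Main.v *)
(* Put phi = f / G, h_k = G T eta_k, A_k = h_k + ... + h_K and
   eps_k = sum_t acc_{k-1,t}. An exact epoch x |-> p satisfies
     h_k (phi p - phi u) <= |x - u|^2 / 2 - |p - u|^2 / 2 + h_k^2 / 2,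
   and an inexact one is a nonexpansive map at distance at most eps_k from it.
   Going backwards in k, the epochs after the k-th are compared with the point
   (1 - l) x_k + l u; convexity of phi turns the resulting bound into one on the
   gap at u, and l = A_{k+1} / A_k telescopes. This choice leaves
   h_k |x_k - u|^2 / (2 A_k^2) unused, which absorbs by AM-GM the error of epoch
   k + 1 as long as h_k <= 2 A_{k+1}. For h_k > 2 A_{k+1} epoch k + 1 is replaced
   by the exact one, which by nonexpansiveness moves the last iterate by at most
   eps_{k+1}, and a better l pays for this displacement. The first epoch has no
   predecessor: unless A_1 <= 3 h_1, where 3 eps_1 h_1 / A_1 covers its
   displacement, it absorbs its own error into one half of what it leaves unused,
   and the other half suffices for the second epoch.
   For the complexity claim the displacement argument alone suffices: it adds
   sum_k eps_k = O(h log K) to the exact bound for constant steps. *)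

Require Import Defs.
From mathcomp Require Import all_boot all_order all_algebra.
From mathcomp Require Import all_classical all_reals all_analysis.
From mathcomp Require Import ring lra zify.

Set Implicit Arguments.
Unset Strict Implicit.
Unset Printing Implicit Defensive.

Import Order.TTheory GRing.Theory Num.Theory.
Import numFieldNormedType.Exports.
Local Open Scope classical_set_scope.
Local Open Scope ring_scope.

Section Euclidean.
Variables (R : realType) (d : nat).
Implicit Types (p q x y u : 'rV[R]_d) (c l : R).

Definition edot x y : R := \sum_(i < d) x ord0 i * y ord0 i.

Lemma edotC x y : edot x y = edot y x.
Proof. by apply: eq_bigr => i _; rewrite mulrC. Qed.

Lemma edotDl x y u : edot (x + y) u = edot x u + edot y u.
Proof. by rewrite -big_split; apply: eq_bigr => i _; rewrite mxE mulrDl. Qed.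

Lemma edotZl c x u : edot (c *: x) u = c * edot x u.
Proof. by rewrite mulr_sumr; apply: eq_bigr => i _; rewrite mxE mulrA. Qed.

Lemma edotDr x y u : edot u (x + y) = edot u x + edot u y.
Proof. by rewrite edotC edotDl !(edotC u). Qed.

Lemma edotZr c x u : edot u (c *: x) = c * edot u x.
Proof. by rewrite edotC edotZl edotC. Qed.

Lemma edotNl x u : edot (- x) u = - edot x u.
Proof. by rewrite -scaleN1r edotZl mulN1r. Qed.

Lemma edotNr x u : edot u (- x) = - edot u x.
Proof. by rewrite edotC edotNl edotC. Qed.

Lemma edot0l u : edot 0 u = 0.
Proof. by rewrite -(scale0r 0) edotZl mul0r. Qed.

Definition edotE := (edotDl, edotDr, edotNl, edotNr, edotZl, edotZr).

Lemma enorm_ge0 x : 0 <= enorm x.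
Proof. exact: sqrtr_ge0. Qed.

Lemma enorm_sqr x : enorm x ^+ 2 = edot x x.
Proof.
rewrite /enorm sqr_sqrtr; first by apply: eq_bigr => i _; rewrite expr2.
by apply: sumr_ge0 => i _; exact: sqr_ge0.
Qed.

Lemma enormZ c x : enorm (c *: x) = `|c| * enorm x.
Proof.
apply/eqP; rewrite -(@eqrXn2 _ 2)// ?mulr_ge0 ?enorm_ge0//.
by rewrite exprMn !enorm_sqr !edotE real_normK ?num_real// expr2 mulrA.
Qed.

Lemma enormN x : enorm (- x) = enorm x.
Proof. by rewrite -scaleN1r enormZ normrN1 mul1r. Qed.

Lemma enorm0 : enorm (0 : 'rV[R]_d) = 0.
Proof. by rewrite -(scale0r 0) enormZ normr0 mul0r. Qed.

Lemma enorm_subC x y : enorm (x - y) = enorm (y - x).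
Proof. by rewrite -enormN opprB. Qed.

Lemma coord_le_enorm x i : `|x ord0 i| <= enorm x.
Proof.
rewrite -(@ler_pXn2r _ 2)// ?nnegrE ?enorm_ge0// enorm_sqr real_normK ?num_real//.
rewrite /edot (bigD1 i)//= -expr2 lerDl; apply: sumr_ge0 => j _.
by rewrite -expr2 sqr_ge0.
Qed.

Lemma norm_le_enorm x : `|x| <= enorm x.
Proof.
rewrite /Num.norm/= mx_normrE; apply: bigmax_le => [|[i j] _]; first exact: enorm_ge0.
by rewrite ord1 coord_le_enorm.
Qed.

Lemma enorm_eq0 x : (enorm x == 0) = (x == 0).
Proof.
apply/eqP/eqP => [x0|->]; last exact: enorm0.
by apply/eqP; rewrite -normr_le0 -x0 norm_le_enorm.
Qed.

Lemma enorm_gt0 x : (0 < enorm x) = (x != 0).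
Proof. by rewrite lt_def enorm_eq0 enorm_ge0 andbT. Qed.

Lemma edot_le x y : edot x y <= enorm x * enorm y.
Proof.
have [->|x0] := eqVneq x 0; first by rewrite edot0l enorm0 mul0r.
have [->|y0] := eqVneq y 0; first by rewrite edotC edot0l enorm0 mulr0.
have xy0 : 0 < 2 * enorm x * enorm y by rewrite !mulr_gt0// enorm_gt0.
rewrite -subr_ge0 -(pmulr_rge0 _ xy0).
have := sqr_ge0 (enorm (enorm y *: x - enorm x *: y)).
by rewrite enorm_sqr !edotE -!enorm_sqr (edotC y x); lra.
Qed.

Lemma enorm_triangle x y : enorm (x + y) <= enorm x + enorm y.
Proof.
rewrite -(@ler_pXn2r _ 2)// ?nnegrE ?addr_ge0 ?enorm_ge0//.
rewrite enorm_sqr !edotE sqrrD !enorm_sqr (edotC y x).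
by have := edot_le x y; lra.
Qed.

Lemma enorm_subD y x u : enorm (x - u) <= enorm (x - y) + enorm (y - u).
Proof. by rewrite -[x - u](subrKA y) enorm_triangle. Qed.

Lemma enorm_four_point p q x y :
  enorm (x - q) ^+ 2 + enorm (y - p) ^+ 2 - enorm (p - x) ^+ 2
    - enorm (q - y) ^+ 2 = 2 * edot (p - q) (x - y).
Proof.
rewrite !enorm_sqr !edotE (edotC x q) (edotC y p) (edotC x p) (edotC y q).
by ring.
Qed.

Lemma enorm_sqr_conv x y l :
  enorm ((1 - l) *: x + l *: y) ^+ 2 =
  (1 - l) * enorm x ^+ 2 + l * enorm y ^+ 2 - l * (1 - l) * enorm (y - x) ^+ 2.
Proof. by rewrite !enorm_sqr !edotE (edotC y x); ring. Qed.

Lemma continuous_enorm : continuous (@enorm R d).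
Proof.
have sum_cont : continuous (fun y : 'rV[R]_d => \sum_(i < d) y ord0 i ^+ 2).
  apply: continuous_big => [|i _ y]; first exact: add_continuous.
  apply: (@continuous_comp _ _ _ (fun v : 'rV[R]_d => v ord0 i) (fun c => c ^+ 2)).
    exact: coord_continuous.
  exact: exprn_continuous.
by move=> x; apply: continuous_comp; [exact: sum_cont|exact: sqrt_continuous].
Qed.

Lemma continuous_enorm_sub x : continuous (fun y => enorm (y - x)).
Proof.
move=> y; apply: (@continuous_comp _ _ _ (fun v : 'rV[R]_d => v - x) (@enorm R d)).
  by apply: continuousB; [exact: cvg_id|exact: cst_continuous].
exact: continuous_enorm.
Qed.

Lemma elipschitz_continuous (G : R) (g : 'rV[R]_d -> R) :
  elipschitz G g -> continuous g.
Proof.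
move=> g_lip y; apply/(@cvgrPdist_le _ _ _ (nbhs y) (nbhs_filter y)) => e e0.
have : {for y, continuous (fun v : 'rV[R]_d => G * enorm (v - y))}.
  by apply: continuousM; [exact: cst_continuous|exact: continuous_enorm_sub].
move/(@cvgrPdist_le _ _ _ (nbhs y) (nbhs_filter y)) => /(_ e e0).
apply: filterS => v; rewrite subrr enorm0 mulr0 sub0r normrN => le_e.
by rewrite distrC; apply: le_trans (g_lip v y) (le_trans (ler_norm _) le_e).
Qed.

Lemma is_argmin_exists (F : 'rV[R]_d -> R) x (r : R) :
  continuous F -> 0 <= r -> (forall y, r <= enorm (y - x) -> F x <= F y) ->
  exists p, is_argmin F p.
Proof.
move=> F_cont r0 F_far; pose A := [set y | enorm (y - x) <= r].
have Ax : A x by rewrite /A/= subrr enorm0.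
have A_compact : compact A.
  apply: bounded_closed_compact.
    exists (`|x| + r); split; first exact: num_real.
    move=> M xM y /= /(le_trans (norm_le_enorm _)) yx.
    by rewrite -(subrK x y) (le_trans (ler_normD _ _))//; lra.
  rewrite (_ : A = (fun y => enorm (y - x)) @^-1` [set s | s <= r])//.
  by apply: closed_comp; [move=> y _; exact: continuous_enorm_sub|exact: closed_le].
have [p _ p_min] :=
  EVT_min_rV (ex_intro _ x Ax) A_compact (continuous_subspaceT F_cont).
exists p => y; have [yr|/ltW ry] := leP (enorm (y - x)) r.
  by apply: p_min; rewrite inE.
by apply: le_trans (p_min x _) (F_far y ry); rewrite inE.
Qed.

Lemma convex_functionP (g : 'rV[R]_d -> R) :
  convex_function (E := 'rV[R]_d) setT g <->
  forall x y l, 0 <= l -> l <= 1 ->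
    g ((1 - l) *: x + l *: y) <= (1 - l) * g x + l * g y.
Proof.
split=> [g_cvx x y l l0 l1|g_cvx l x y _ _].
  have := g_cvx (Itv01 l0 l1) y x (in_setT _) (in_setT _).
  by rewrite convRE /conv/= [X in g X <= _]addrC [X in _ <= X]addrC.
rewrite convRE /conv/= [X in g X <= _]addrC [X in _ <= X]addrC.
exact: g_cvx (ge0 _) (le1 _).
Qed.

End Euclidean.

Section Prox.
Variables (R : realType) (d : nat) (G eta : R) (g : 'rV[R]_d -> R).
Hypotheses (eta0 : 0 < eta) (G0 : 0 <= G).
Hypothesis g_cvx : convex_function (E := 'rV[R]_d) setT g.
Hypothesis g_lip : elipschitz G g.
Implicit Types (p q x y u : 'rV[R]_d) (l : R).

Let eta2_gt0 : 0 < 2 * eta. Proof. by rewrite mulr_gt0. Qed.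

Let objective x y := (2 * eta)^-1 * enorm (y - x) ^+ 2 + g y.

Lemma continuous_prox_objective x : continuous (objective x).
Proof.
suff cont_at (y : 'rV[R]_d) : {for y, continuous (objective x)} by exact: cont_at.
apply: continuousD; last exact: elipschitz_continuous g_lip y.
have sqr_cont : {for y, continuous (fun v : 'rV[R]_d => enorm (v - x) ^+ 2)}.
  apply: (@continuous_comp _ _ _ (fun v : 'rV[R]_d => enorm (v - x))
    (fun c : R => c ^+ 2)); first exact: continuous_enorm_sub.
  exact: exprn_continuous.
by apply: continuousM; [exact: cst_continuous|exact: sqr_cont].
Qed.

Lemma prox_argmin x : is_argmin (objective x) (prox eta g x).
Proof.
rewrite /prox; case: xgetP => [_ ->//|no_argmin]; exfalso.
suff [p /no_argmin] : exists p, is_argmin (objective x) p by [].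
apply: (is_argmin_exists (x := x) (r := 2 * eta * G)).
- exact: continuous_prox_objective.
- by rewrite mulr_ge0// ltW.
move=> y far; rewrite /objective subrr enorm0 expr0n mulr0 add0r.
have : G * enorm (y - x) <= (2 * eta)^-1 * enorm (y - x) ^+ 2.
  by rewrite expr2 mulrA ler_wpM2r ?enorm_ge0// ler_pdivlMl.
by have := le_trans (ler_norm _) (g_lip x y); rewrite (enorm_subC x); lra.
Qed.

Lemma prox_gap_conv x u l : 0 < l -> l <= 1 ->
  (1 - l) * enorm (prox eta g x - u) ^+ 2 <=
  enorm (x - u) ^+ 2 - enorm (prox eta g x - x) ^+ 2
    - 2 * eta * (g (prox eta g x) - g u).
Proof.
move=> l0 l1; set p := prox eta g x.
have /convex_functionP/(_ p u l (ltW l0) l1) g_pu := g_cvx.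
have := le_trans (prox_argmin x ((1 - l) *: p + l *: u)) (lerD (lexx _) g_pu).
rewrite /objective -/p (_ : _ + _ - x = (1 - l) *: (p - x) + l *: (u - x)); last first.
  by apply/rowP => i; rewrite !mxE; ring.
rewrite enorm_sqr_conv (_ : u - x - (p - x) = - (p - u)); last first.
  by apply/rowP => i; rewrite !mxE; ring.
rewrite enormN -(ler_pM2l eta2_gt0) !mulrDr !mulVKf ?gt_eqF// => gap.
by rewrite -(ler_pM2l l0) (enorm_subC x u); lra.
Qed.

Lemma prox_gap x u :
  2 * eta * (g (prox eta g x) - g u) <=
  enorm (x - u) ^+ 2 - enorm (prox eta g x - u) ^+ 2
    - enorm (prox eta g x - x) ^+ 2.
Proof.
suff : enorm (prox eta g x - u) ^+ 2 <=
    enorm (x - u) ^+ 2 - enorm (prox eta g x - x) ^+ 2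
      - 2 * eta * (g (prox eta g x) - g u) by lra.
rewrite -lee_fin; apply/lee_mul01Pr => [|l /andP[l0 l1]].
  by rewrite lee_fin sqr_ge0.
have := @prox_gap_conv x u (1 - l); rewrite -EFinM lee_fin subKr.
by move=> /(_ _ _)/wrap[||]; lra.
Qed.

Lemma prox_dist x : enorm (prox eta g x - x) <= eta * G.
Proof.
have := prox_gap x x; rewrite subrr enorm0.
set p := prox eta g x; have := le_trans (ler_norm _) (g_lip x p).
rewrite enorm_subC; set n := enorm (p - x) => gxp gap.
have [n0|] := leP n 0; first by rewrite (le_trans n0)// mulr_ge0// ltW.
by move=> n0; rewrite -(ler_pM2l n0); have := ler_wpM2l (ltW eta0) gxp; lra.
Qed.

Lemma prox_nonexpansive x y :
  enorm (prox eta g x - prox eta g y) <= enorm (x - y).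
Proof.
have := prox_gap x (prox eta g y).
have := prox_gap y (prox eta g x).
move: (prox eta g x) (prox eta g y) => p q; rewrite (enorm_subC q p) => gap_y gap_x.
have : enorm (p - q) ^+ 2 <= enorm (p - q) * enorm (x - y).
  by apply: le_trans (edot_le _ _); have := enorm_four_point p q x y; lra.
have [/le_trans-> //|pq0] := leP (enorm (p - q)) 0; first exact: enorm_ge0.
by rewrite expr2 ler_pM2l.
Qed.

End Prox.

Section Sweep.
Variables (V : Type) (F : nat -> V -> V).
Implicit Types (m n : nat) (v : V).

Definition sweep m n v := foldl (fun w k => F k w) v (index_iota m n).

Lemma sweep_geq m n v : (n <= m)%N -> sweep m n v = v.
Proof. by rewrite /sweep /index_iota -subn_eq0 => /eqP->. Qed.

Lemma sweep_ltn m n v : (m < n)%N -> sweep m n v = sweep m.+1 n (F m v).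
Proof. by move=> mn; rewrite /sweep /index_iota -(subnSK mn). Qed.

Lemma sweep_recr m n v : (m <= n)%N -> sweep m n.+1 v = F n (sweep m n v).
Proof.
move=> mn; rewrite /sweep /index_iota subSn// -addn1 iotaD subnKC//.
by rewrite cats1 foldl_rcons.
Qed.

Lemma sweep_trace m n (w : nat -> V) : (m <= n)%N ->
  (forall k, (m <= k < n)%N -> w k.+1 = F k (w k)) -> sweep m n (w m) = w n.
Proof.
elim: n => [|n IHn]; first by rewrite leqn0 => /eqP-> _; rewrite sweep_geq.
rewrite leq_eqVlt => /predU1P[-> _|]; first by rewrite sweep_geq.
rewrite ltnS => mn w_rec; rewrite sweep_recr// w_rec ?mn ?ltnSn// IHn// => k mkn.
by apply: w_rec; lia.
Qed.

End Sweep.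

Section NonexpansiveSweep.
Variables (R : realType) (d m : nat).
Implicit Types (F P Q : nat -> 'rV[R]_d -> 'rV[R]_d) (n : nat) (x y : 'rV[R]_d).

Definition enonexpansive (F : 'rV[R]_d -> 'rV[R]_d) :=
  forall x y, enorm (F x - F y) <= enorm (x - y).

Lemma sweep_nonexpansive F n :
  (forall k, (m <= k < n)%N -> enonexpansive (F k)) ->
  enonexpansive (sweep F m n).
Proof.
elim: n => [|n IHn] F_ne x y; first by rewrite !sweep_geq.
have [nm|mn] := ltnP n m; first by rewrite !sweep_geq.
rewrite !sweep_recr//; apply: le_trans (F_ne n _ _ _) (IHn _ x y); first lia.
by move=> k mkn; apply: F_ne; lia.
Qed.

Lemma sweep_close P Q (e : nat -> R) n x :
  (forall k, (m <= k < n)%N -> enonexpansive (Q k)) ->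
  (forall k y, (m <= k < n)%N -> enorm (Q k y - P k y) <= e k) ->
  enorm (sweep Q m n x - sweep P m n x) <= \sum_(m <= k < n) e k.
Proof.
elim: n => [|n IHn] Q_ne QP; first by rewrite !sweep_geq// subrr enorm0 big_geq.
have [nm|mn] := ltnP n m; first by rewrite !sweep_geq// subrr enorm0 big_geq.
rewrite !sweep_recr// big_nat_recr//=.
apply: le_trans (enorm_subD (Q n (sweep P m n x)) _ _) _; apply: lerD.
  apply: le_trans (Q_ne n _ _ _) (IHn _ _); first lia.
    by move=> k mkn; apply: Q_ne; lia.
  by move=> k y mkn; apply: QP; lia.
by apply: QP; lia.
Qed.

End NonexpansiveSweep.

Section Scaling.
Variables (R : realType) (d : nat) (c : R) (g : 'rV[R]_d -> R).
Hypothesis c0 : 0 <= c.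

Lemma elipschitzM (G : R) :
  elipschitz G g -> elipschitz (c * G) (fun x => c * g x).
Proof.
by move=> g_lip x y; rewrite -mulrBr normrM ger0_norm// -mulrA ler_wpM2l.
Qed.

Lemma convex_functionM : convex_function (E := 'rV[R]_d) setT g ->
  convex_function (E := 'rV[R]_d) setT (fun x => c * g x).
Proof.
move=> /convex_functionP g_cvx; apply/convex_functionP => x y l l0 l1.
by rewrite !(mulrCA _ c) -mulrDr ler_wpM2l// g_cvx.
Qed.

End Scaling.

Definition descent_step (R : realType) (d : nat) (phi : 'rV[R]_d -> R) (h : R)
    (P : 'rV[R]_d -> 'rV[R]_d) :=
  forall x u, h * (phi (P x) - phi u) <=
    enorm (x - u) ^+ 2 / 2 - enorm (P x - u) ^+ 2 / 2 + h ^+ 2 / 2.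

Section Epoch.
Variables (R : realType) (d T : nat) (G : R) (f : nat -> 'rV[R]_d -> R).
Hypothesis G0 : 0 <= G.
Hypothesis fP : forall t, (0 < t <= T)%N ->
  convex_function (E := 'rV[R]_d) setT (f t) /\ elipschitz G (f t).
Implicit Types (x y u : 'rV[R]_d) (n : nat) (e : nat -> 'rV[R]_d).

Lemma sum_elipschitz n : (n <= T)%N ->
  elipschitz (n%:R * G) (fun x => \sum_(1 <= t < n.+1) f t x).
Proof.
move=> nT x y; rewrite -sumrB; apply: le_trans (ler_norm_sum _ _ _) _.
have -> : n%:R * G * enorm (x - y) = \sum_(1 <= t < n.+1) G * enorm (x - y).
  by rewrite sumr_const_nat subn1 -mulrA mulr_natl.
rewrite !big_nat; apply: ler_sum => t /andP[t0 tn].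
by apply: (fP _).2; rewrite t0 (leq_trans _ nT).
Qed.

Lemma sum_convex :
  convex_function (E := 'rV[R]_d) setT (fun x => \sum_(1 <= t < T.+1) f t x).
Proof.
apply/convex_functionP => x y l l0 l1; rewrite !mulr_sumr -big_split/= !big_nat.
by apply: ler_sum => t /fP[/convex_functionP f_conv _]; exact: f_conv.
Qed.

Lemma favg_elipschitz : (0 < T)%N -> elipschitz G (favg T f).
Proof.
move=> T0; have T_gt0 : 0 < T%:R :> R by rewrite ltr0n.
rewrite -[G](mulKf (lt0r_neq0 T_gt0)).
by apply: elipschitzM (sum_elipschitz (leqnn T)); rewrite invr_ge0.
Qed.

Lemma favg_convex : convex_function (E := 'rV[R]_d) setT (favg T f).
Proof. by apply: convex_functionM sum_convex; rewrite invr_ge0. Qed.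

Definition exact_epoch eta := sweep (fun t => prox eta (f t)) 1 T.+1.

Definition inexact_epoch eta e :=
  sweep (fun t y => prox eta (f t) y + e t) 1 T.+1.

Variable eta : R.
Hypothesis eta0 : 0 < eta.

Lemma exact_epoch_nonexpansive : enonexpansive (exact_epoch eta).
Proof.
by apply: sweep_nonexpansive => t /fP[f_cvx f_lip]; exact: prox_nonexpansive f_lip.
Qed.

Lemma perturbed_prox_nonexpansive e t : (0 < t <= T)%N ->
  enonexpansive (fun y => prox eta (f t) y + e t).
Proof.
move=> /fP[f_cvx f_lip] x y; rewrite opprD addrACA subrr addr0.
exact: prox_nonexpansive f_lip _ _.
Qed.

Lemma inexact_epoch_nonexpansive e : enonexpansive (inexact_epoch eta e).
Proof. by apply: sweep_nonexpansive => t; exact: perturbed_prox_nonexpansive. Qed.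

Lemma inexact_epoch_close e x :
  enorm (inexact_epoch eta e x - exact_epoch eta x)
    <= \sum_(1 <= t < T.+1) enorm (e t).
Proof.
apply: sweep_close => t; first exact: perturbed_prox_nonexpansive.
by move=> y _; rewrite addrC addKr.
Qed.

Let prox_sweep n := sweep (fun t => prox eta (f t)) 1 n.+1.

Lemma prox_sweep_descent n x u : (n <= T)%N ->
  eta * (\sum_(1 <= t < n.+1) f t (prox_sweep n x) - \sum_(1 <= t < n.+1) f t u) <=
  enorm (x - u) ^+ 2 / 2 - enorm (prox_sweep n x - u) ^+ 2 / 2
    + (n%:R * G * eta) ^+ 2 / 2.
Proof.
elim: n => [|n IHn] nT.
  rewrite /prox_sweep sweep_geq// !big_geq// subrr mulr0 !mul0r expr0n mul0r.
  by rewrite addr0 subrr.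
have [f_cvx f_lip] : convex_function (E := 'rV[R]_d) setT (f n.+1)
    /\ elipschitz G (f n.+1) by apply: fP; rewrite nT.
have {IHn} := IHn (ltnW nT); rewrite /prox_sweep [sweep _ _ n.+2 _]sweep_recr//.
move: (sweep _ 1 n.+1 x) => y IH.
have := prox_gap eta0 G0 f_cvx f_lip y u.
have := prox_dist eta0 G0 f_cvx f_lip y.
set p := prox _ _ y => py gap.
have /= sum_lip := le_trans (ler_norm _) (sum_elipschitz (ltnW nT) p y).
have nG0 : 0 <= eta * (n%:R * G) by rewrite !mulr_ge0// ltW.
have := ler_wpM2l nG0 py; have := ler_wpM2l (ltW eta0) sum_lip.
have := sqr_ge0 (enorm (p - y)); have := sqr_ge0 (eta * G).
by rewrite -(natr1 n) !(big_nat_recr n.+1)//=; lra.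
Qed.

Lemma exact_epoch_descent : (0 < T)%N -> 0 < G ->
  descent_step (fun y => G^-1 * favg T f y) (G * T%:R * eta) (exact_epoch eta).
Proof.
move=> T0 G_gt0 x u; have T_gt0 : 0 < T%:R :> R by rewrite ltr0n.
have := prox_sweep_descent x u (leqnn T); rewrite [T%:R * G]mulrC.
apply: le_trans; rewrite le_eqVlt; apply: predU1l.
by rewrite /favg /exact_epoch /prox_sweep; field; rewrite !gt_eqF.
Qed.

End Epoch.

Lemma restart_weight_interior (R : realFieldType) (rho g r M : R) :
  2 <= rho -> 0 < r -> 0 <= g -> g <= r ->
  rho * g <= M - r ^+ 2 / 2 -> rho ^+ 2 / 2 <= M ->
  g - g ^+ 2 / r ^+ 2 / 2 + rho / 12 <= M / (1 + rho).
Proof.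
move=> rho2 r0 g0 gr gM rhoM; pose w := g ^+ 2 / r ^+ 2.
have w1 : w <= 1 by rewrite ler_pdivrMr ?exprn_gt0// mul1r ler_sqr ?nnegrE// ltW.
(* For [rho = 2] the claim is an equality at [M = 2], [g = 2 / 3] and
   [r ^+ 2 = 4 / 3], where the square vanishes. *)
have square_ge0 : 0 <= r ^+ 2 - 2 * ((rho + 4) / 3) * g + ((rho + 4) / 3) ^+ 2 * w.
  rewrite (_ : _ + _ = (r - (rho + 4) / 3 * (g / r)) ^+ 2) ?sqr_ge0//.
  by rewrite /w; field; rewrite gt_eqF.
rewrite -/w ler_pdivlMr; last by lra.
have : 0 <= (rho - 2) * (rho - 2) * (1 - w) by rewrite !mulr_ge0 ?subr_ge0.
lra.
Qed.

(* [l] minimizes the left-hand side. The slack [rho / 12] comes from [g <= r]: a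
   large [r] makes [M] exceed [rho * g], and a small one makes [g] small while
   [rho ^+ 2 / 2 <= M]. *)
Lemma restart_weight_unit_exists (R : realFieldType) (rho g r M : R) :
  2 <= rho -> 0 <= r -> g <= r -> rho * g <= M - r ^+ 2 / 2 ->
  rho ^+ 2 / 2 <= M ->
  exists l, [/\ 0 <= l, l <= 1 &
    (1 - l) * g + l ^+ 2 * r ^+ 2 / 2 + rho / 12 <= M / (1 + rho)].
Proof.
move=> rho2 r0 gr gM rhoM.
have M_ge : 3 / 4 * (rho * g + r ^+ 2 / 2) + rho ^+ 2 / 8 <= M by lra.
have [g0|g0] := leP g 0.
  by exists 0; split; rewrite ?ler01// ler_pdivlMr//; nra.
have [rg|gr2] := leP (r ^+ 2) g.
  by exists 1; split; rewrite ?ler01// ler_pdivlMr//; nra.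
have r2_gt0 : 0 < r ^+ 2 by lra.
have r_gt0 : 0 < r by lra.
exists (g / r ^+ 2); split.
- by rewrite divr_ge0// ltW.
- by rewrite ler_pdivrMr// mul1r ltW.
apply: le_trans (restart_weight_interior rho2 r_gt0 (ltW g0) gr gM rhoM).
rewrite lerD2r le_eqVlt; apply: predU1l.
by field; rewrite gt_eqF.
Qed.

Lemma restart_weight_exists (R : realFieldType) (a h g r M : R) :
  0 < a -> 2 * a <= h -> 0 <= r -> g <= r -> h * g <= M - r ^+ 2 / 2 ->
  h ^+ 2 / 2 <= M ->
  exists l, [/\ 0 <= l, l <= 1 &
    (1 - l) * g + (l * r) ^+ 2 / (2 * a) + h / 12 <= M / (a + h)].
Proof.
move=> a0 ah r0 gr gM hM; have an0 : a != 0 by rewrite gt_eqF.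
have a20 : 0 < a ^+ 2 by rewrite exprn_gt0.
have [|||||l [l0 l1 unit_le]] :=
  @restart_weight_unit_exists R (h / a) (g / a) (r / a) (M / a ^+ 2).
- by rewrite ler_pdivlMr.
- by rewrite divr_ge0// ltW.
- by rewrite ler_pM2r ?invr_gt0.
- rewrite [leLHS](_ : _ = (h * g) / a ^+ 2); last by field.
  rewrite [leRHS](_ : _ = (M - r ^+ 2 / 2) / a ^+ 2); last by field.
  by rewrite ler_pM2r ?invr_gt0.
- by rewrite expr_div_n mulrAC ler_pM2r ?invr_gt0.
exists l; split => //.
have ah0 : a + h != 0 by lra.
have := ler_wpM2l (ltW a0) unit_le.
rewrite [leLHS](_ : _ = (1 - l) * g + (l * r) ^+ 2 / (2 * a) + h / 12); last by field.
by rewrite [leRHS](_ : _ = M / (a + h)) //; field; rewrite ?an0 ?ah0.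
Qed.

(* With [x = h / A], the maximum of [x * (1 - 3 * x)] is [1 / 12]. *)
Lemma displacement_cost_le (R : realFieldType) (A h hp e : R) :
  0 < A -> 0 <= hp -> 0 <= e -> e <= h * hp / A -> e <= 3 * e * h / A + hp / 12.
Proof.
move=> A0 hp0 e0; rewrite mulrAC -[3 * e * h / A]mulrA; set x := h / A => e_le.
have [x3|x3] := leP 1 (3 * x); first by have := ler_wpM2l e0 x3; lra.
have x3' : 0 <= 1 - 3 * x by lra.
have := ler_wpM2r x3' e_le; have := mulr_ge0 hp0 (sqr_ge0 (x - 6^-1)); lra.
Qed.

Section Gap.
Variables (R : realType) (d : nat) (phi : 'rV[R]_d -> R).
Hypothesis phi_cvx : convex_function (E := 'rV[R]_d) setT phi.
Hypothesis phi_lip : elipschitz 1 phi.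
Implicit Types (x y z p u v : 'rV[R]_d) (c e h l q theta : R).

Lemma gap_le_dist x y : phi x - phi y <= enorm (x - y).
Proof. by apply: le_trans (ler_norm _) _; rewrite -[leRHS]mul1r phi_lip. Qed.

Lemma gap_segment y z u q c l : 0 <= l -> l <= 1 ->
  (forall v, phi z - phi v <= q * enorm (y - v) ^+ 2 + c) ->
  phi z - phi u <= (1 - l) * (phi y - phi u) + q * (l * enorm (y - u)) ^+ 2 + c.
Proof.
move=> l0 l1 /(_ ((1 - l) *: y + l *: u)).
have -> : y - ((1 - l) *: y + l *: u) = l *: (y - u).
  by apply/rowP => i; rewrite !mxE; ring.
rewrite enormZ ger0_norm// => gap.
by have /convex_functionP/(_ y u l l0 l1) := phi_cvx; lra.
Qed.

Lemma gap_restart_proportional y z u a h theta c : 0 < a -> 0 < h ->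
  (forall v, phi z - phi v <= (1 + theta * h / a) / (2 * a) * enorm (y - v) ^+ 2 + c) ->
  phi z - phi u <=
  (h * (phi y - phi u) + (1 - (1 - theta) * h / (a + h)) * enorm (y - u) ^+ 2 / 2)
    / (a + h) + c.
Proof.
move=> a0 h0 gap; have ah0 : 0 < a + h by lra.
have l0 : 0 <= a / (a + h) by rewrite divr_ge0 ?ltW.
have l1 : a / (a + h) <= 1 by rewrite ler_pdivrMr//; lra.
apply: le_trans (gap_segment u l0 l1 gap) _.
by rewrite lerD2r le_eqVlt; apply: predU1l; field; rewrite !gt_eqF.
Qed.

Lemma gap_perturb y p u h e : 0 <= h -> enorm (y - p) <= e ->
  h * (phi y - phi u) + enorm (y - u) ^+ 2 / 2 <=
  h * (phi p - phi u) + enorm (p - u) ^+ 2 / 2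
    + e * (h + enorm (p - u)) + e ^+ 2 / 2.
Proof.
move=> h0 yp; have e0 := le_trans (enorm_ge0 _) yp.
have : enorm (y - u) ^+ 2 <= (enorm (p - u) + e) ^+ 2.
  rewrite ler_sqr ?nnegrE ?addr_ge0 ?enorm_ge0//.
  by have := enorm_subD p y u; lra.
by have := ler_wpM2l h0 (le_trans (gap_le_dist y p) yp); lra.
Qed.

Lemma gap_perturb_absorbed y p u a h e :
  0 < h -> 3 * h <= a -> e * a <= h ^+ 2 -> enorm (y - p) <= e ->
  h * (phi y - phi u) + (1 - h / (2 * a)) * enorm (y - u) ^+ 2 / 2 <=
  h * (phi p - phi u) + enorm (p - u) ^+ 2 / 2 + 3 * e * h.
Proof.
move=> h0 ha eah yp; have e0 := le_trans (enorm_ge0 _) yp; have a0 : 0 < a by lra.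
have perturb := gap_perturb u (ltW h0) yp; set r := enorm (y - u) in perturb *.
have pu : enorm (p - u) <= e + r.
  by have := enorm_subD y p u; rewrite (enorm_subC p y) -/r; lra.
have am_gm : e * r <= h / a * r ^+ 2 / 4 + e * h.
  have ah0 : 0 < 4 * a * h by rewrite !mulr_gt0.
  rewrite -(ler_pM2r ah0) [leRHS](_ : _ = (h * r) ^+ 2 + 4 * (e * a) * h ^+ 2).
    have := sqr_ge0 (h * r - 2 * (e * a)).
    by have := ler_wpM2l (mulr_ge0 e0 (ltW a0)) eah; lra.
  by field; rewrite gt_eqF.
have e_small : e <= h / 3.
  rewrite -(ler_pM2r a0); apply: le_trans eah _.
  by have := ler_wpM2l (ltW h0) ha; lra.
rewrite invfM; have := ler_wpM2l e0 e_small; have := ler_wpM2l e0 pu.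
by have := mulr_ge0 e0 (ltW h0); lra.
Qed.

(* If [P x] is already better than [u], its distance to [u] is not controlled, but
   [v = P x] will do. *)
Lemma descent_comparison (P : 'rV[R]_d -> 'rV[R]_d) h x u :
  0 < h -> descent_step phi h P ->
  exists v, [/\ phi v <= phi u,
    h * (phi (P x) - phi v) + enorm (P x - v) ^+ 2 / 2
      <= enorm (x - u) ^+ 2 / 2 + h ^+ 2 / 2 &
    enorm (P x - v) ^+ 2 <= enorm (x - u) ^+ 2 + h ^+ 2].
Proof.
move=> h0 P_descent; have s0 := sqr_ge0 (enorm (x - u)); have hh0 := sqr_ge0 h.
have [Pu|uP] := leP (phi (P x)) (phi u).
  by exists (P x); split=> //; rewrite !subrr enorm0 expr0n/=; lra.
exists u; split=> //; first by have := P_descent x u; lra.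
have : 0 <= h * (phi (P x) - phi u) by rewrite mulr_ge0 ?subr_ge0// ltW.
by have := P_descent x u; lra.
Qed.

End Gap.

Section TailSum.
Variables (R : realType) (w : nat -> R) (K : nat).

Definition tail_sum k := \sum_(k <= j < K.+1) w j.

Lemma tail_sum_rec k : (k <= K)%N -> tail_sum k = w k + tail_sum k.+1.
Proof. by move=> kK; rewrite /tail_sum big_ltn. Qed.

Lemma tail_sum_out : tail_sum K.+1 = 0.
Proof. by rewrite /tail_sum big_geq. Qed.

Lemma tail_sum_gt0 k : (forall j, (0 < j <= K)%N -> 0 < w j) ->
  (0 < k <= K)%N -> 0 < tail_sum k.
Proof.
move=> w0 kK; rewrite tail_sum_rec; last by case/andP: kK.
rewrite ltr_pwDl ?w0// /tail_sum big_nat sumr_ge0// => j kj.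
by apply/ltW/w0; lia.
Qed.

End TailSum.

Section LastIterate.
Variables (R : realType) (d : nat) (phi : 'rV[R]_d -> R) (h eps : nat -> R).
Variables (P Q : nat -> 'rV[R]_d -> 'rV[R]_d) (K : nat).
Implicit Types (x y u : 'rV[R]_d) (k : nat).

Hypothesis phi_cvx : convex_function (E := 'rV[R]_d) setT phi.
Hypothesis phi_lip : elipschitz 1 phi.
Hypothesis h_gt0 : forall k, (0 < k <= K)%N -> 0 < h k.
Hypothesis P_descent : forall k, (0 < k <= K)%N -> descent_step phi (h k) (P k).
Hypothesis Q_close : forall k x, (0 < k <= K)%N -> enorm (Q k x - P k x) <= eps k.
Hypothesis Q_nonexpansive : forall k, (0 < k <= K)%N -> enonexpansive (Q k).

Local Notation A := (tail_sum h K).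
Let epoch_cost k := h k ^+ 2 / (2 * A k) + 3 * eps k * h k / A k.
Local Notation cost := (tail_sum epoch_cost K).
Local Notation last k := (sweep Q k K.+1).

Let A_gt0 k : (0 < k <= K)%N -> 0 < A k. Proof. exact: tail_sum_gt0. Qed.

Let eps_ge0 k : (0 < k <= K)%N -> 0 <= eps k.
Proof. by move=> kK; apply: le_trans (enorm_ge0 _) (Q_close 0 kK). Qed.

(* [M] stands for [enorm (x - u) ^+ 2 / 2 + h k ^+ 2 / 2] plus the error of epoch [k],
   [x] being the start of that epoch and [y] its end. *)
Definition completion_bound k := forall y u M,
  h k * (phi y - phi u) <= M - enorm (y - u) ^+ 2 / 2 -> h k ^+ 2 / 2 <= M ->
  phi (last k.+1 y) - phi u <= M / A k + cost k.+1.

Lemma completion_bound_last : (0 < K)%N -> completion_bound K.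
Proof.
move=> K0 y u M gM _; have hK : 0 < h K by rewrite h_gt0// K0 leqnn.
rewrite sweep_geq// tail_sum_rec// !tail_sum_out !addr0 ler_pdivlMr// mulrC.
by have := sqr_ge0 (enorm (y - u)); lra.
Qed.

Lemma last_iterate_displaced k x u : (0 < k <= K)%N -> completion_bound k ->
  phi (last k x) - phi u <=
  enorm (x - u) ^+ 2 / (2 * A k) + h k ^+ 2 / (2 * A k) + cost k.+1 + eps k.
Proof.
move=> kK completion.
have : phi (last k.+1 (P k x)) - phi u <=
    (enorm (x - u) ^+ 2 / 2 + h k ^+ 2 / 2) / A k + cost k.+1.
  apply: completion; first by have := P_descent kK x u; lra.
  by rewrite lerDr divr_ge0// sqr_ge0.
have : phi (last k x) - phi (last k.+1 (P k x)) <= eps k.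
  rewrite sweep_ltn; last by case/andP: kK.
  apply: le_trans (gap_le_dist phi_lip _ _) (le_trans _ (Q_close x kK)).
  by apply: sweep_nonexpansive => j kj; apply: Q_nonexpansive; lia.
by rewrite mulrDl -!mulrA -!invfM; lra.
Qed.

Lemma last_iterate_absorbed k c x u : (0 < k <= K)%N -> completion_bound k ->
  0 < c -> eps k + (c + c^-1) * h k <= 4 * h k ->
  phi (last k x) - phi u <=
  (1 + eps k / (c * h k)) / (2 * A k) * enorm (x - u) ^+ 2 + cost k.
Proof.
move=> kK completion c0 eps_le; have Ak0 := A_gt0 kK; have hk0 := h_gt0 kK.
have e0 := eps_ge0 kK; have k_le_K : (k <= K)%N by case/andP: kK.
have [v [vu desc dist]] := descent_comparison x u hk0 (P_descent kK).
set s := enorm (x - u) in desc dist *; set r := enorm (P k x - v) in desc dist.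
pose M := (1 + eps k / (c * h k)) * s ^+ 2 / 2 + h k ^+ 2 / 2 + 3 * eps k * h k.
apply: le_trans (_ : phi (last k x) - phi v <= _); first by lra.
rewrite (tail_sum_rec epoch_cost)// [leRHS](_ : _ = M / A k + cost k.+1); last first.
  by rewrite /M /epoch_cost; field; rewrite !gt_eqF.
rewrite sweep_ltn//; apply: completion; last first.
  rewrite /M; have : 0 <= (1 + eps k / (c * h k)) * s ^+ 2.
    by rewrite mulr_ge0 ?sqr_ge0// addr_ge0// divr_ge0// mulr_ge0// ltW.
  by have := mulr_ge0 e0 (ltW hk0); lra.
have am_gm : eps k * r <= eps k / (c * h k) * s ^+ 2 / 2
    + eps k * ((c + c^-1) * h k) / 2.
  have -> : eps k / (c * h k) * s ^+ 2 / 2 + eps k * ((c + c^-1) * h k) / 2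
      = eps k * (((s ^+ 2 + h k ^+ 2) / (c * h k) + c * h k) / 2).
    by field; rewrite !gt_eqF.
  have ch0 : 0 < c * h k by rewrite mulr_gt0.
  rewrite ler_wpM2l// ler_pdivlMr// -(ler_pM2r ch0) mulrDl divfK ?gt_eqF//.
  by have := sqr_ge0 (r - c * h k); lra.
have := gap_perturb phi_lip v (ltW hk0) (Q_close x kK).
by have := ler_wpM2l e0 eps_le; rewrite /M -/r; lra.
Qed.

Lemma last_iterate_restarted k c y u : (0 < k < K)%N -> completion_bound k.+1 ->
  eps k.+1 <= h k.+1 * h k / A k.+1 ->
  0 < c -> h k <= (4 - c - c^-1) * A k.+1 ->
  phi (last k.+1 y) - phi u <=
  (h k * (phi y - phi u) + (1 - (1 - c^-1) * h k / A k) * enorm (y - u) ^+ 2 / 2)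
    / A k + cost k.+1.
Proof.
move=> kK next eps_le c0 hA; have k_range : (0 < k <= K)%N by lia.
have kS_range : (0 < k.+1 <= K)%N by lia.
have hk0 := h_gt0 k_range; have hkS0 := h_gt0 kS_range; have a0 := A_gt0 kS_range.
have AkE : A k = A k.+1 + h k by rewrite tail_sum_rec 1?addrC//; lia.
have eps_ratio : eps k.+1 / h k.+1 <= h k / A k.+1.
  by rewrite ler_pdivrMr// mulrAC [h k * _]mulrC.
rewrite AkE; apply: (gap_restart_proportional phi_cvx u a0 hk0) => v.
apply: le_trans (last_iterate_absorbed y v kS_range next c0 _) _.
  have : eps k.+1 / h k.+1 <= 4 - c - c^-1.
    by apply: le_trans eps_ratio _; rewrite ler_pdivrMr.
  by rewrite ler_pdivrMr//; lra.
rewrite lerD2r ler_wpM2r ?sqr_ge0// ler_pM2r ?invr_gt0 ?mulr_gt0// lerD2l.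
by rewrite invfM mulrCA -[leRHS]mulrA ler_pM2l ?invr_gt0.
Qed.

Lemma completion_bound_step k : (0 < k < K)%N -> completion_bound k.+1 ->
  eps k.+1 <= h k.+1 * h k / A k.+1 -> completion_bound k.
Proof.
move=> kK next eps_le y u M gM hM; have k_range : (0 < k <= K)%N by lia.
have kS_range : (0 < k.+1 <= K)%N by lia.
have AkE : A k = A k.+1 + h k by rewrite tail_sum_rec 1?addrC//; lia.
have hk0 := h_gt0 k_range; have a0 := A_gt0 kS_range.
have [ha|ah] := leP (h k) (2 * A k.+1).
  apply: le_trans (last_iterate_restarted y u kK next eps_le ltr01 _) _.
    by rewrite invr1; lra.
  by rewrite lerD2r invr1 subrr !mul0r subr0 mul1r ler_pM2r ?invr_gt0//; lra.
have g_le : phi y - phi u <= enorm (y - u) by exact: gap_le_dist.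
have [l [l0 l1 weight]] := restart_weight_exists a0 (ltW ah) (enorm_ge0 _) g_le gM hM.
have costE : cost k.+1 = epoch_cost k.+1 + cost k.+2 by rewrite tail_sum_rec//; lia.
rewrite /epoch_cost in costE.
have disp v : phi (last k.+1 y) - phi v <=
    (2 * A k.+1)^-1 * enorm (y - v) ^+ 2 + (h k / 12 + cost k.+1).
  apply: le_trans (last_iterate_displaced y v kS_range next) _; rewrite costE.
  by have := displacement_cost_le a0 (ltW hk0) (eps_ge0 kS_range) eps_le; lra.
by rewrite AkE; have := gap_segment phi_cvx u l0 l1 disp; lra.
Qed.

Hypothesis eps_le : forall k, (1 < k <= K)%N -> eps k <= h k * h k.-1 / A k.

Lemma completion_bound_all k : (0 < k <= K)%N -> completion_bound k.
Proof.
have [n] := ubnP (K - k); elim: n k => // n IHn k kn kK.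
have [->|k_neq_K] := eqVneq k K; first by apply: completion_bound_last; lia.
by apply: completion_bound_step; [lia|apply: IHn; lia|apply: eps_le; lia].
Qed.

Lemma first_epoch_absorbed x u : (0 < K)%N -> eps 1%N <= h 1%N ^+ 2 / A 1 ->
  3 * h 1%N < A 1 ->
  phi (last 1 x) - phi u <= enorm (x - u) ^+ 2 / (2 * A 1) + cost 1.
Proof.
move=> K0; have first_range : (0 < 1 <= K)%N by lia.
have A10 := A_gt0 first_range; have h10 := h_gt0 first_range.
have A1E : A 1 = h 1%N + A 2 by rewrite tail_sum_rec.
rewrite ler_pdivlMr// => eps1 hA.
have K_gt1 : (0 < 1 < K)%N.
  rewrite /= ltn_neqAle K0 andbT; apply: contraTneq hA => K_eq1.
  by rewrite A1E -K_eq1 tail_sum_out -leNgt; lra.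
rewrite (tail_sum_rec epoch_cost)// sweep_ltn//.
have next : completion_bound 2 by apply: completion_bound_all; lia.
have eps2 : eps 2%N <= h 2%N * h 1%N / A 2 by apply: eps_le; lia.
have := last_iterate_restarted (Q 1%N x) u K_gt1 next eps2 (ltr0n _ 2).
move=> /(_ _)/wrap[|restarted]; first by lra.
apply: le_trans restarted _; rewrite addrA lerD2r ler_pdivrMr// /epoch_cost.
have -> : (enorm (x - u) ^+ 2 / (2 * A 1) + (h 1%N ^+ 2 / (2 * A 1)
    + 3 * eps 1%N * h 1%N / A 1)) * A 1
  = enorm (x - u) ^+ 2 / 2 + h 1%N ^+ 2 / 2 + 3 * eps 1%N * h 1%N.
  by field; rewrite gt_eqF.
have := gap_perturb_absorbed phi_lip u h10 (ltW hA) eps1 (Q_close x first_range).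
by rewrite invfM; have := P_descent first_range x u; lra.
Qed.

Theorem last_iterate_bound x u : (0 < K)%N -> eps 1%N <= h 1%N ^+ 2 / A 1 ->
  phi (last 1 x) - phi u <= enorm (x - u) ^+ 2 / (2 * A 1) + cost 1.
Proof.
move=> K0 eps1; have first_range : (0 < 1 <= K)%N by lia.
have [hA|] := leP (A 1) (3 * h 1%N); last exact: first_epoch_absorbed.
rewrite (tail_sum_rec epoch_cost)// /epoch_cost.
apply: le_trans
  (last_iterate_displaced x u first_range (completion_bound_all first_range)) _.
suff : eps 1%N <= 3 * eps 1%N * h 1%N / A 1 by lra.
rewrite ler_pdivlMr ?A_gt0//.
by have := ler_wpM2l (eps_ge0 first_range) hA; lra.
Qed.

End LastIterate.

Section Displacement.
Variables (R : realType) (d : nat) (phi : 'rV[R]_d -> R) (h eps : nat -> R).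
Variables (P Q : nat -> 'rV[R]_d -> 'rV[R]_d) (K : nat).
Implicit Types (x u : 'rV[R]_d).

Hypothesis phi_cvx : convex_function (E := 'rV[R]_d) setT phi.
Hypothesis phi_lip : elipschitz 1 phi.
Hypothesis h_gt0 : forall k, (0 < k <= K)%N -> 0 < h k.
Hypothesis P_descent : forall k, (0 < k <= K)%N -> descent_step phi (h k) (P k).
Hypothesis P_nonexpansive : forall k, (0 < k <= K)%N -> enonexpansive (P k).

Lemma exact_last_iterate_bound x u : (0 < K)%N ->
  phi (sweep P 1 K.+1 x) - phi u <=
  enorm (x - u) ^+ 2 / (2 * tail_sum h K 1)
    + \sum_(1 <= k < K.+1) h k ^+ 2 / (2 * tail_sum h K k).
Proof.
move=> K0; have A_gt0 k : (0 < k <= K)%N -> 0 < tail_sum h K k.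
  exact: tail_sum_gt0.
have P_close k y : (0 < k <= K)%N -> enorm (P k y - P k y) <= 0.
  by rewrite subrr enorm0.
apply: le_trans (last_iterate_bound (eps := fun=> 0) phi_cvx phi_lip h_gt0
  P_descent P_close P_nonexpansive _ x u K0 _) _.
- move=> k kK; rewrite divr_ge0 ?mulr_ge0// ltW// ?h_gt0 ?A_gt0//; lia.
- by rewrite divr_ge0 ?sqr_ge0// ltW// A_gt0.
rewrite lerD2l /tail_sum; apply: ler_sum => k _.
by rewrite mulr0 !mul0r addr0.
Qed.

(* Nonexpansiveness transports every displacement unamplified to the last iterate. *)
Lemma inexact_last_iterate_bound x u : (0 < K)%N ->
  (forall k y, (0 < k <= K)%N -> enorm (Q k y - P k y) <= eps k) ->
  (forall k, (0 < k <= K)%N -> enonexpansive (Q k)) ->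
  phi (sweep Q 1 K.+1 x) - phi u <=
  enorm (x - u) ^+ 2 / (2 * tail_sum h K 1)
    + \sum_(1 <= k < K.+1) (h k ^+ 2 / (2 * tail_sum h K k) + eps k).
Proof.
move=> K0 Q_close Q_ne; rewrite big_split/= addrA.
have := exact_last_iterate_bound x u K0.
have := gap_le_dist phi_lip (sweep Q 1 K.+1 x) (sweep P 1 K.+1 x).
have := @sweep_close _ _ 1%N P Q eps K.+1 x Q_ne Q_close.
lra.
Qed.

End Displacement.

Section Run.
Variables (R : realType) (d T K : nat) (G : R) (f : nat -> 'rV[R]_d -> R).
Variables (x0 : 'rV[R]_d) (eta : nat -> R) (acc : nat -> nat -> R).
Variables (x : nat -> 'rV[R]_d) (z : nat -> nat -> 'rV[R]_d).
Hypotheses (T0 : (0 < T)%N) (K0 : (0 < K)%N) (G0 : 0 < G).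
Hypothesis fP : forall t, (0 < t <= T)%N ->
  convex_function (E := 'rV[R]_d) setT (f t) /\ elipschitz G (f t).
Hypothesis eta_gt0 : forall k, (0 < k <= K)%N -> 0 < eta k.
Hypothesis run : ipm_run T K f eta acc x0 x z.

Let T_gt0 : 0 < T%:R :> R. Proof. by rewrite ltr0n. Qed.

Let err k t := z k.-1 t.+1 - prox (eta k) (f t) (z k.-1 t).
Let P k := exact_epoch T f (eta k).
Let Q k := inexact_epoch T f (eta k) (err k).
Let phi y := G^-1 * favg T f y.
Let h k := G * T%:R * eta k.
Let eps k := \sum_(1 <= t < T.+1) acc k.-1 t.

Lemma run_last : sweep Q 1 K.+1 x0 = x K.
Proof.
case: run => <- runK.
apply: (@sweep_trace _ Q 1 K.+1 (fun k => x k.-1)) => // k /runK[z1 _ ->].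
rewrite -z1 /Q /inexact_epoch.
by rewrite (@sweep_trace _ _ 1 T.+1 (z k.-1))// => t _; rewrite addrC subrK.
Qed.

Lemma run_h_gt0 k : (0 < k <= K)%N -> 0 < h k.
Proof. by move=> kK; rewrite !mulr_gt0// eta_gt0. Qed.

Lemma run_descent k : (0 < k <= K)%N -> descent_step phi (h k) (P k).
Proof. move=> kK; exact (exact_epoch_descent (ltW G0) fP (eta_gt0 kK) T0 G0). Qed.

Lemma run_close k y : (0 < k <= K)%N -> enorm (Q k y - P k y) <= eps k.
Proof.
move=> kK; apply: le_trans (inexact_epoch_close (ltW G0) fP (eta_gt0 kK) _ _) _.
rewrite /eps !big_nat; apply: ler_sum => t tT.
by case: run => _ /(_ k kK)[_ acc_le _]; exact: acc_le.
Qed.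

Lemma run_exact_nonexpansive k : (0 < k <= K)%N -> enonexpansive (P k).
Proof. move=> kK; exact (exact_epoch_nonexpansive (ltW G0) fP (eta_gt0 kK)). Qed.

Lemma run_inexact_nonexpansive k : (0 < k <= K)%N -> enonexpansive (Q k).
Proof. move=> kK; exact (inexact_epoch_nonexpansive (ltW G0) fP (eta_gt0 kK) _). Qed.

Lemma run_potential_convex : convex_function (E := 'rV[R]_d) setT phi.
Proof. by apply: convex_functionM (favg_convex fP); rewrite invr_ge0 ltW. Qed.

Lemma run_potential_elipschitz : elipschitz 1 phi.
Proof.
rewrite -(mulVf (lt0r_neq0 G0)).
by apply: elipschitzM (favg_elipschitz fP T0); rewrite invr_ge0 ltW.
Qed.

Lemma run_gap y u : favg T f y - favg T f u = G * (phi y - phi u).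
Proof. by rewrite /phi -(mulrBr G^-1) mulVKf// gt_eqF. Qed.

Lemma run_tail_sum k : tail_sum h K k = G * T%:R * tail_sum eta K k.
Proof. by rewrite /tail_sum mulr_sumr. Qed.

Lemma run_bound u : eta 0%N = eta 1%N ->
  (forall k, (0 < k <= K)%N ->
    eps k <= eta k * eta k.-1 * G * T%:R / tail_sum eta K k) ->
  favg T f (x K) - favg T f u
    <= enorm (x0 - u) ^+ 2 / (2 * T%:R * tail_sum eta K 1)
     + G ^+ 2 * T%:R / 2
         * (\sum_(1 <= k < K.+1) (eta k ^+ 2 / tail_sum eta K k))
     + \sum_(1 <= k < K.+1) \sum_(1 <= t < T.+1)
         (acc k.-1 t ^+ 2 / (2 * T%:R * tail_sum eta K k)
          + 3 * G * acc k.-1 t * eta k / tail_sum eta K k).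
Proof.
move=> eta01 acc_le.
have a_gt0 k : (0 < k <= K)%N -> 0 < tail_sum eta K k by exact: tail_sum_gt0.
have eps_le k : (0 < k <= K)%N -> eps k <= h k * h k.-1 / tail_sum h K k.
  move=> kK; rewrite (le_trans (acc_le k kK))// run_tail_sum le_eqVlt.
  by apply/orP; left; apply/eqP; rewrite /h; field; rewrite !gt_eqF// a_gt0.
have first_range : (0 < 1 <= K)%N by lia.
have eps1 : eps 1%N <= h 1%N ^+ 2 / tail_sum h K 1.
  by rewrite (le_trans (eps_le _ first_range))// /h/= eta01 -expr2.
have := last_iterate_bound run_potential_convex run_potential_elipschitz run_h_gt0
  run_descent run_close run_inexact_nonexpansive _ x0 u K0 eps1.
rewrite run_last => /(_ _)/wrap[k kK|]; first by apply: eps_le; lia.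
rewrite run_gap -(ler_pM2l G0) => /le_trans; apply.
rewrite mulrDr -addrA lerD//.
  rewrite run_tail_sum le_eqVlt; apply: predU1l.
  by field; rewrite !gt_eqF// a_gt0.
rewrite {1}/tail_sum !mulr_sumr -big_split/= !big_nat; apply: ler_sum => k kK.
have a0 := a_gt0 k kK; rewrite run_tail_sum.
set a := tail_sum eta K k in a0 *.
have -> : G * (h k ^+ 2 / (2 * (G * T%:R * a)) + 3 * eps k * h k / (G * T%:R * a))
    = G ^+ 2 * T%:R / 2 * (eta k ^+ 2 / a) + 3 * G * eta k / a * eps k.
  by rewrite /h; field; rewrite !gt_eqF.
rewrite lerD2l mulr_sumr; apply: ler_sum => t _.
have -> : 3 * G * eta k / a * acc k.-1 t = 3 * G * acc k.-1 t * eta k / a by ring.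
by rewrite lerDr divr_ge0 ?sqr_ge0// !mulr_ge0// ltW.
Qed.

Lemma run_displacement_bound u :
  favg T f (x K) - favg T f u <=
  G * (enorm (x0 - u) ^+ 2 / (2 * tail_sum h K 1)
    + \sum_(1 <= k < K.+1) (h k ^+ 2 / (2 * tail_sum h K k) + eps k)).
Proof.
rewrite run_gap ler_pM2l// -run_last.
exact: inexact_last_iterate_bound run_potential_convex run_potential_elipschitz
  run_h_gt0 run_descent run_exact_nonexpansive _ _ K0 run_close
  run_inexact_nonexpansive.
Qed.

End Run.

Lemma harmonic_le_ln (R : realType) K : (0 < K)%N ->
  \sum_(1 <= j < K.+1) j%:R^-1 <= 1 + ln K%:R :> R.
Proof.
case: K => // K _; elim: K => [|K IHK]; first by rewrite big_nat1 invr1 ln1 addr0.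
rewrite big_nat_recr//=; apply: le_trans (lerD IHK (lexx _)) _; rewrite -addrA lerD2l.
have K_gt0 : 0 < K.+1%:R :> R by [].
have := @le_ln1Dx R (- K.+2%:R^-1); rewrite ltrN2 invf_lt1// ltr1n => /(_ isT).
rewrite (_ : 1 + - _ = K.+1%:R / K.+2%:R); last first.
  by rewrite -(natr1 K.+1); field; apply: lt0r_neq0; lra.
by rewrite ln_div ?posrE//; move: (ln _) (ln _) (_^-1) => a b c; lra.
Qed.

Lemma run_constant_step (R : realType) (d T K : nat) (G eta : R)
    (f : nat -> 'rV[R]_d -> R) (x0 u : 'rV[R]_d) (acc : nat -> nat -> R)
    (x : nat -> 'rV[R]_d) (z : nat -> nat -> 'rV[R]_d) (h := G * T%:R * eta) :
  (0 < T)%N -> (0 < K)%N -> 0 < G -> 0 < eta ->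
  (forall t, (0 < t <= T)%N ->
    convex_function (E := 'rV[R]_d) setT (f t) /\ elipschitz G (f t)) ->
  ipm_run T K f (fun=> eta) acc x0 x z ->
  (forall k, (0 < k <= K)%N -> \sum_(1 <= t < T.+1) acc k.-1 t
     <= 2 * eta * G * T%:R / (K - k + 1)%:R) ->
  favg T f (x K) - favg T f u <=
  G * (enorm (x0 - u) ^+ 2 / (2 * h * K%:R) + 5 / 2 * h * (1 + ln K%:R)).
Proof.
move=> T0 K0 G0 eta0 fP run acc_le; have h0 : 0 < h by rewrite !mulr_gt0// ltr0n.
have A_E k : (0 < k <= K)%N -> tail_sum (fun=> h) K k = h * (K - k + 1)%:R.
  by move=> kK; rewrite /tail_sum sumr_const_nat mulr_natr; congr (_ *+ _); lia.
apply: le_trans (run_displacement_bound T0 K0 G0 fP (fun _ _ => eta0) run u) _.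
rewrite ler_pM2l// lerD//.
  by rewrite -/h A_E// subn1 addn1 prednK// mulrA.
apply: le_trans (_ : 5 / 2 * h * \sum_(1 <= k < K.+1) k%:R^-1 <= _); last first.
  by rewrite ler_wpM2l ?harmonic_le_ln// mulr_ge0 ?ltW.
rewrite mulr_sumr [leRHS]big_nat_rev/= !big_nat; apply: ler_sum => k kK.
apply: le_trans (lerD (lexx _) (acc_le k kK)) _; rewrite -/h A_E//.
rewrite (_ : (1 + K.+1 - k.+1)%N = (K - k + 1)%N); last by lia.
have : 0 < (K - k + 1)%:R :> R by rewrite ltr0n addn1.
move: (_%:R) => c c0; rewrite le_eqVlt; apply: predU1l.
by rewrite /h; field; rewrite !gt_eqF// ltr0n.
Qed.

Section Complexity.
Variable R : realType.
Implicit Types (X Y : R) (K n T : nat).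

Lemma exp2_le_expR n : 2 ^+ n <= expR n%:R :> R.
Proof.
rewrite -[n%:R]mulr1 expRM_natl lerXn2r ?nnegrE ?expR_ge0//.
by have := expR_ge1Dx (1 : R); lra.
Qed.

Lemma ln_expR1D_ge1 X : 0 <= X -> 1 <= ln (expR 1 + X).
Proof.
by move=> X0; rewrite -[leLHS]expRK ler_ln ?posrE ?ltr_pwDl ?expR_gt0 ?lerDl.
Qed.

Definition epoch_budget Y := expR 16 * Y ^+ 2 * ln (expR 1 + Y ^+ 2) ^+ 2.

Lemma epoch_budget_ge1 Y : 1 <= Y -> 1 <= epoch_budget Y.
Proof.
move=> Y1; have e16 : 1 <= expR 16 :> R by rewrite -[leLHS]expR0 ler_expR.
by rewrite /epoch_budget !mulr_ege1 ?exprn_ege1 ?ln_expR1D_ge1 ?sqr_ge0.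
Qed.

Lemma sqrt_epoch_budget Y : 1 <= Y ->
  Num.sqrt (epoch_budget Y) = expR 8 * Y * ln (expR 1 + Y ^+ 2).
Proof.
move=> Y1; have l1 := ln_expR1D_ge1 (sqr_ge0 Y).
rewrite /epoch_budget (_ : 16 = 2%:R * 8); last by ring.
rewrite expRM_natl -!exprMn sqrtr_sqr ger0_norm// !mulr_ge0 ?expR_ge0//; lra.
Qed.

Lemma ln_epoch_budget_le Y : 1 <= Y ->
  ln (2 * epoch_budget Y) <= 17 + 3 * ln (expR 1 + Y ^+ 2).
Proof.
move=> Y1; rewrite /epoch_budget; set l := ln (expR 1 + _).
have Y0 : 0 < Y by lra.
have l0 : 0 < l by apply: lt_le_trans (ln_expR1D_ge1 (sqr_ge0 Y)).
have -> : ln (2 * (expR 16 * Y ^+ 2 * l ^+ 2)) = ln 2 + (16 + ln Y *+ 2 + ln l *+ 2).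
  rewrite -!lnXn// -[16 in RHS](expRK 16).
  by rewrite -!lnM ?posrE ?mulr_gt0 ?exprn_gt0 ?expR_gt0.
have ln2 : ln 2 <= 1 :> R.
  by rewrite -[leRHS]expRK ler_ln ?posrE ?expR_gt0// (exp2_le_expR 1).
have lnY : ln Y *+ 2 <= l.
  by rewrite -lnXn// ler_ln ?posrE ?addr_gt0 ?expR_gt0 ?exprn_gt0// lerDr expR_ge0.
by have := ln_sublinear l0; rewrite !(mulr2n (ln _)) in lnY *; lra.
Qed.

Lemma epochs_exist Y : 1 <= Y ->
  exists K, [/\ (0 < K)%N, K%:R <= 2 * epoch_budget Y &
    Y * (3 + 5 / 2 * ln K%:R) <= Num.sqrt K%:R].
Proof.
move=> Y1; have W1 := epoch_budget_ge1 Y1.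
have l1 := ln_expR1D_ge1 (sqr_ge0 Y).
have /andP[W_ge W_lt] := truncn_itv (le_trans ler01 W1).
set W := epoch_budget Y in W1 W_ge W_lt *.
exists (Num.truncn W).+1; rewrite -natr1; set k : R := _ + 1.
have kW : k <= 2 * W by rewrite /k; lra.
have k0 : 0 < k by rewrite /k; lra.
split=> //; apply: le_trans (_ : Num.sqrt W <= _); last first.
  by rewrite ler_wsqrtr// /k natr1 ltW.
rewrite sqrt_epoch_budget// [leRHS]mulrAC mulrC ler_wpM2r//; first lra.
have e8 := exp2_le_expR 8.
have lnk : ln k <= 17 + 3 * ln (expR 1 + Y ^+ 2).
  apply: le_trans (ln_epoch_budget_le Y1).
  by rewrite -/W ler_ln ?posrE//; lra.
have := ler_wpM2r (le_trans ler01 l1) e8; lra.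
Qed.

Lemma soft_epoch_budget Y T X : 1 <= Y -> (0 < T)%N -> X = T%:R * Y ^+ 2 ->
  T%:R * (2 * epoch_budget Y) <= soft_bigO (2 * expR 16) 2 X.
Proof.
move=> Y1 T0 ->; have l1 := ln_expR1D_ge1 (sqr_ge0 Y).
have Y20 := sqr_ge0 Y.
have YX : Y ^+ 2 <= T%:R * Y ^+ 2 by rewrite ler_peMl// ler1n.
have lX : ln (expR 1 + Y ^+ 2) <= ln (expR 1 + T%:R * Y ^+ 2).
  by rewrite ler_ln ?posrE ?ltr_pwDl ?expR_gt0 ?lerD2l// mulr_ge0.
rewrite /soft_bigO -[X in _ `^ X]/(2%:R) powR_mulrn; last by lra.
rewrite (_ : _ * _ = 2 * expR 16 * (T%:R * Y ^+ 2) * ln (expR 1 + Y ^+ 2) ^+ 2).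
  by rewrite ler_wpM2l// ?ler_sqr ?nnegrE ?mulr_ge0 ?expR_ge0//; lra.
by rewrite /epoch_budget; ring.
Qed.

(* [eta] makes the step [h = G * T * eta] equal to [D / sqrt K], which balances
   [D ^+ 2 / (2 * h * K)] against the multiples of [h]. *)
Lemma epochs_step_exist T (G D epsilon : R) :
  (0 < T)%N -> 0 < G -> 0 <= D -> 0 < epsilon ->
  let X := G ^+ 2 * T%:R * D ^+ 2 / epsilon ^+ 2 in
  T%:R <= X ->
  exists K eta, let h := G * T%:R * eta in
    [/\ (0 < K)%N, 0 < eta, (T * K)%:R <= soft_bigO (2 * expR 16) 2 X &
      G * (D ^+ 2 / (2 * h * K%:R) + 5 / 2 * h * (1 + ln K%:R)) <= epsilon].
Proof.
move=> T0 G0 D0 e0 X TX; have T_gt0 : 0 < T%:R :> R by rewrite ltr0n.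
pose Y := G * D / epsilon.
have XE : X = T%:R * Y ^+ 2 by rewrite /X /Y; field; rewrite gt_eqF.
have Y0 : 0 <= Y by rewrite divr_ge0 ?mulr_ge0 // ltW.
have Y1 : 1 <= Y.
  by rewrite -(@ler_pXn2r _ 2) ?nnegrE// expr1n -(ler_pMr _ T_gt0) -XE.
have [K [K0 K_le K_ge]] := epochs_exist Y1.
pose s := Num.sqrt K%:R : R.
have s0 : 0 < s by rewrite sqrtr_gt0 ltr0n.
have sK : K%:R = s ^+ 2 by rewrite sqr_sqrtr.
have D_gt0 : 0 < D.
  rewrite lt_def D0 andbT; apply: contraTneq Y1 => D_eq0.
  by rewrite /Y D_eq0 mulr0 mul0r -ltNge.
exists K, (D / (G * T%:R * s)); split=> //.
- by rewrite divr_gt0// !mulr_gt0.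
- rewrite natrM; apply: le_trans (soft_epoch_budget Y1 T0 XE).
  by rewrite ler_wpM2l.
rewrite -/s in K_ge; move: (ln K%:R) K_ge => L K_ge; rewrite sK.
have -> : G * (D ^+ 2 / (2 * (G * T%:R * (D / (G * T%:R * s))) * s ^+ 2)
    + 5 / 2 * (G * T%:R * (D / (G * T%:R * s))) * (1 + L))
  = epsilon * (Y * (3 + 5 / 2 * L) / s) by rewrite /Y; field; rewrite !gt_eqF.
by rewrite ger_pMr// ler_pdivrMr// mul1r.
Qed.

End Complexity.

Theorem corollary3p5 (R : realType) :
  (forall (d T K : nat) (G : R) (f : nat -> 'rV[R]_d -> R)
      (x0 xstar : 'rV[R]_d) (eta : nat -> R) (acc : nat -> nat -> R)
      (x : nat -> 'rV[R]_d) (z : nat -> nat -> 'rV[R]_d),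
    (1 <= T)%N -> (1 <= K)%N -> 0 < G ->
    (forall t, (1 <= t <= T)%N ->
      convex_function (E := 'rV[R]_d) setT (f t) /\ elipschitz G (f t)) ->
    is_argmin (favg T f) xstar ->
    (forall k, (1 <= k <= K)%N -> 0 < eta k) ->
    eta 0%N = eta 1%N ->
    (forall k t, (1 <= k <= K)%N -> (1 <= t <= T)%N -> 0 < acc k.-1 t) ->
    ipm_run T K f eta acc x0 x z ->
    (forall k, (1 <= k <= K)%N ->
      \sum_(1 <= t < T.+1) acc k.-1 t
        <= eta k * eta k.-1 * G * T%:R / \sum_(k <= j < K.+1) eta j) ->
    favg T f (x K) - favg T f xstar
      <= enorm (x0 - xstar) ^+ 2 / (2 * T%:R * \sum_(1 <= k < K.+1) eta k)
       + G ^+ 2 * T%:R / 2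
           * (\sum_(1 <= k < K.+1) (eta k ^+ 2 / \sum_(k <= j < K.+1) eta j))
       + \sum_(1 <= k < K.+1) \sum_(1 <= t < T.+1)
           (acc k.-1 t ^+ 2 / (2 * T%:R * \sum_(k <= j < K.+1) eta j)
            + 3 * G * acc k.-1 t * eta k / \sum_(k <= j < K.+1) eta j))
  /\
  (exists C p : R, [/\ 0 < C, 0 < p &
    forall (d T : nat) (G D epsilon : R),
      (1 <= T)%N -> 0 < G -> 0 <= D -> 0 < epsilon ->
      let X := G ^+ 2 * T%:R * D ^+ 2 / epsilon ^+ 2 in
      T%:R <= X ->
      exists (K : nat) (eta : R),
        [/\ (1 <= K)%N, 0 < eta, (T * K)%:R <= soft_bigO C p X &
          forall (f : nat -> 'rV[R]_d -> R) (x0 xstar : 'rV[R]_d)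
              (acc : nat -> nat -> R)
              (x : nat -> 'rV[R]_d) (z : nat -> nat -> 'rV[R]_d),
            (forall t, (1 <= t <= T)%N ->
              convex_function (E := 'rV[R]_d) setT (f t)
              /\ elipschitz G (f t)) ->
            is_argmin (favg T f) xstar ->
            enorm (x0 - xstar) = D ->
            (forall k t, (1 <= k <= K)%N -> (1 <= t <= T)%N ->
              0 < acc k.-1 t) ->
            ipm_run T K f (fun=> eta) acc x0 x z ->
            (forall k, (1 <= k <= K)%N ->
              \sum_(1 <= t < T.+1) acc k.-1 t
                <= 2 * eta * G * T%:R / (K - k + 1)%:R) ->
            favg T f (x K) - favg T f xstar <= epsilon]]).
Proof.
split=> [d T K G f x0 xstar eta acc x z T0 K0 G0 fP _ eta0 eta01 _ run acc_le|].
  exact: run_bound T0 K0 G0 fP eta0 run xstar eta01 acc_le.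
exists (2 * expR 16), 2; split=> // d T G D epsilon T0 G0 D0 e0 X TX.
have [K [eta [K0 eta0 TK h_le]]] := epochs_step_exist T0 G0 D0 e0 TX.
exists K, eta; split=> // f x0 xstar acc x z fP _ x0D _ run acc_le.
apply: le_trans h_le; rewrite -x0D.
exact: run_constant_step T0 K0 G0 eta0 fP run acc_le.
Qed.
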